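(* Let $\varphi:\mathbb R_+^2\to\mathbb R_+$ be a CFMM trading function satisfying properties (I)–(IV) listed in the context, and let $u_1,u_2,v:\mathbb R_+^2\to\mathbb R_+$ each satisfy properties (I)–(IV). Then the following are equivalent: (i) $v$ is a strong representative agent for $u_1,u_2$ (relative to $\varphi$); (ii) $\Lambda_{u_1}\boxplus\Lambda_{u_2}=\Lambda_v$; (iii) $u_1$, $u_2$ and $v$ are equivalent to the same homothetic preference.
   Context: Notation: $\mathbb R_+=[0,\infty)$, $\mathbb R_{++}=(0,\infty)$. For a function $u$ that is differentiable with nonzero partial derivatives at $(x,y)$, put $p(u,x,y):=\partial_xu(x,y)/\partial_yu(x,y)$. Properties of a function $u:\mathbb R_+^2\to\mathbb R_+$: (I) $u$ is continuous, $u(x,0)=u(0,y)=0$ for all $x,y\in\mathbb R_+$, and $u$ is strictly increasing (in each coordinate) on $\mathbb R_{++}^2$. (II) $\lim_{x'\to\infty}u(x',y)=\infty$ and $\lim_{y'\to\infty}u(x,y')=\infty$ for every $x,y>0$. (III) $u$ is continuously differentiable and strictly concave on $\mathbb R_{++}^2$. (IV) For any $x_1,x_2,y_1,y_2\in\mathbb R_{++}$ with $x_1\le x_2$ and $y_1\ge y_2$, at least one inequality strict, $p(u,x_1,y_1)>p(u,x_2,y_2)$ whenever the prices are defined. Level curves: if $u$ satisfies (I) and (II), then for each $c>0$ the level set $u^{-1}(c)$ is the graph of a function $\ell_{u,c}:\mathbb R_{++}\to\mathbb R_{++}$. Put $\Lambda_u=\{\ell_{u,c}:c>0\}$. For $f,g:\mathbb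 R_{++}\to\mathbb R_{++}$, $(f\boxplus g)(x)=\inf\{f(x_1)+g(x_2):x_1,x_2>0,\ x_1+x_2=x\}$ for $x>0$, and $\Lambda_{u_1}\boxplus\Lambda_{u_2}=\{\ell_{u_1,c_1}\boxplus\ell_{u_2,c_2}:c_1,c_2>0\}$. Equivalence and homotheticity: two functions $u,v$ on $\mathbb R_+^2$ are equivalent if for all $\mathbf r,\mathbf r'\in\mathbb R_+^2$, $u(\mathbf r)\ge u(\mathbf r')\iff v(\mathbf r)\ge v(\mathbf r')$. A utility function $w:\mathbb R_+^2\to\mathbb R_+$ is homogeneous (of degree one) if $w(kx,ky)=kw(x,y)$ for all $x,y,k>0$. A utility function represents a homothetic preference if it is equivalent to a homogeneous utility function. ''Equivalent to the same homothetic preference'' means that the functions are pairwise equivalent and represent a homothetic preference. Market: a market state is $\mathbf R=(\mathbf r_0,\mathbf r_1,\mathbf r_2)\in(\mathbb R_+^2)^3$ ($\mathbf r_0$ = CFMM inventory, $\mathbf r_i$ = holding of agent $i$), interior if in $(\mathbb R_{++}^2)^3$. $\mathcal U(\mathbf R^{\mathsf{in}})$ is the set of market states $\mathbf R$ with $\mathbf r_0+\mathbf r_1+\mathbf r_2=\mathbf r_0^{\mathsf{in}}+\mathbf r_1^{\mathsf{in}}+\mathbf r_2^{\mathsf{in}}$, $\varphi(\mathbf r_0)=\varphi(\mathbf r_0^{\mathsf{in}})$ and $u_i(\mathbf r_i)\ge u_i(\mathbf r_i^{\mathsf{in}})$, $i=1,2$. A trade $\mathbf h\in\mathbb R^2$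 is valid for $\mathbf R$ and agent $i$ if $\mathbf r_0+\mathbf h\in\mathbb R_+^2$, $\varphi(\mathbf r_0+\mathbf h)=\varphi(\mathbf r_0)$ and $\mathbf r_i-\mathbf h\in\mathbb R_+^2$. A market state is a unilateral equilibrium if for each $i\in\{1,2\}$ there is no valid trade $\mathbf h$ with $u_i(\mathbf r_i-\mathbf h)>u_i(\mathbf r_i)$. Representative agents: given an interior $\mathbf R^{\mathsf{in}}$ and a unilateral equilibrium $\mathbf R^*\in\mathcal U(\mathbf R^{\mathsf{in}})$, put $\mathbf r_A^{\mathsf{in}}=\mathbf r_1^{\mathsf{in}}+\mathbf r_2^{\mathsf{in}}$ and $\mathbf h^*=\mathbf r_0^*-\mathbf r_0^{\mathsf{in}}$. A function $u_A$ is a weak representative agent for $(\mathbf R^{\mathsf{in}},\mathbf R^* )$ if $\mathbf h^*$ maximizes $u_A(\mathbf r_A^{\mathsf{in}}-\mathbf h)$ over all $\mathbf h\in\mathbb R^2$ with $\mathbf r_0^{\mathsf{in}}+\mathbf h\in\mathbb R_+^2$, $\varphi(\mathbf r_0^{\mathsf{in}}+\mathbf h)=\varphi(\mathbf r_0^{\mathsf{in}})$ and $\mathbf r_A^{\mathsf{in}}-\mathbf h\in\mathbb R_+^2$. A function $u_A$ is a strong representative agent for $u_1,u_2$ relative to $\varphi$ if this same $u_A$ is a weak representative agent for $(\mathbf R^{\mathsf{in}},\mathbf R^* )$ for every interior initial state $\mathbf R^{\mathsf{in}}$ and every unilateral equilibrium $\mathbf R^*\in\mathcal U(\mathbf R^{\mathsf{in}})$.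 *)

(* Defs.v *)
(* A function R_+^2 -> R_+ is encoded as a total function
   u : R * R -> R that is nonnegative on the closed quadrant; every notion below
   reads its values on that quadrant only. *)
From HB Require Import structures.
From mathcomp Require Import all_boot all_order all_algebra.
From mathcomp Require Import all_classical all_reals all_analysis.

Set Implicit Arguments.
Unset Strict Implicit.
Unset Printing Implicit Defensive.

Import Order.TTheory GRing.Theory Num.Theory.
Import numFieldNormedType.Exports.

Local Open Scope classical_set_scope.
Local Open Scope ring_scope.

Definition nneg2 {R : realType} : set (R * R) := [set z | 0 <= z.1 /\ 0 <= z.2].

Definition pos2 {R : realType} : set (R * R) := [set z | 0 < z.1 /\ 0 < z.2].

Definition nneg_valued {R : realType} (u : R * R -> R) : Prop :=
  forall z, nneg2 z -> 0 <= u z.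

Definition dx {R : realType} (u : R * R -> R) (z : R * R) : R :=
  'D_((1, 0) : R * R) u z.

Definition dy {R : realType} (u : R * R -> R) (z : R * R) : R :=
  'D_((0, 1) : R * R) u z.

Definition price {R : realType} (u : R * R -> R) (z : R * R) : R :=
  dx u z / dy u z.

Definition price_defined {R : realType} (u : R * R -> R) (z : R * R) : Prop :=
  [/\ differentiable u z, dx u z != 0 & dy u z != 0].

Definition propI {R : realType} (u : R * R -> R) : Prop :=
  [/\ {within nneg2, continuous u},
      forall x, 0 <= x -> u (x, 0) = 0,
      forall y, 0 <= y -> u (0, y) = 0,
      forall x x' y, 0 < x -> 0 < y -> x < x' -> u (x, y) < u (x', y) &
      forall x y y', 0 < x -> 0 < y -> y < y' -> u (x, y) < u (x, y')].

Definition propII {R : realType} (u : R * R -> R) : Prop :=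
  (forall y : R, 0 < y -> u (t, y) @[t --> +oo%R] --> +oo%R) /\
  (forall x : R, 0 < x -> u (x, t) @[t --> +oo%R] --> +oo%R).

Definition strictly_concave_on {R : realType} (D : set (R * R))
    (u : R * R -> R) : Prop :=
  forall (z z' : R * R) (t : R), D z -> D z' -> z != z' -> 0 < t -> t < 1 ->
    t * u z + (1 - t) * u z' < u (t *: z + (1 - t) *: z').

Definition propIII {R : realType} (u : R * R -> R) : Prop :=
  (forall z, pos2 z ->
     [/\ differentiable u z, {for z, continuous (dx u)} &
         {for z, continuous (dy u)}]) /\
  strictly_concave_on pos2 u.

Definition propIV {R : realType} (u : R * R -> R) : Prop :=
  forall x1 x2 y1 y2 : R, 0 < x1 -> 0 < x2 -> 0 < y1 -> 0 < y2 ->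
    x1 <= x2 -> y2 <= y1 -> (x1 < x2) || (y2 < y1) ->
    price_defined u (x1, y1) -> price_defined u (x2, y2) ->
    price u (x2, y2) < price u (x1, y1).

Definition satisfies_I_IV {R : realType} (u : R * R -> R) : Prop :=
  [/\ nneg_valued u, propI u, propII u, propIII u & propIV u].

(* The domain R_{++} is the type {posnum R}, so that equality of level curves is
   equality of functions on R_{++}.  The codomain is R, with positivity stated
   separately: an infimal convolution of positive functions is a priori only
   nonnegative. *)
Definition is_level_curve {R : realType} (u : R * R -> R) (c : R)
    (f : {posnum R} -> R) : Prop :=
  (forall x, 0 < f x) /\
  [set z | nneg2 z /\ u z = c] = range (fun x : {posnum R} => (x%:num, f x)).

Definition Lambda {R : realType} (u : R * R -> R) : set ({posnum R} -> R) :=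
  [set f | exists2 c : R, 0 < c & is_level_curve u c f].

Definition infconv {R : realType} (f g : {posnum R} -> R) :
    {posnum R} -> R :=
  fun x => inf [set s | exists x1 x2 : {posnum R},
                          x1%:num + x2%:num = x%:num /\ s = f x1 + g x2].

Definition infconv_set {R : realType} (F G : set ({posnum R} -> R)) :
    set ({posnum R} -> R) :=
  [set infconv f g | f in F & g in G].

Definition equivalent {R : realType} (u v : R * R -> R) : Prop :=
  forall r r', nneg2 r -> nneg2 r' -> (u r' <= u r <-> v r' <= v r).

Definition homogeneous1 {R : realType} (w : R * R -> R) : Prop :=
  forall x y k : R, 0 < x -> 0 < y -> 0 < k -> w (k * x, k * y) = k * w (x, y).

Definition represents_homothetic {R : realType} (u : R * R -> R) : Prop :=
  exists w, [/\ nneg_valued w, homogeneous1 w & equivalent u w].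

Definition same_homothetic {R : realType} (u1 u2 v : R * R -> R) : Prop :=
  [/\ equivalent u1 u2, equivalent u2 v & equivalent u1 v] /\
  [/\ represents_homothetic u1, represents_homothetic u2 &
      represents_homothetic v].

(* r0 is the CFMM inventory, r1 and r2 the holdings of the two agents;
   nonnegativity is the separate predicate is_market_state. *)
Record mstate (R : realType) := MState {
  r0 : R * R;
  r1 : R * R;
  r2 : R * R }.

Definition is_market_state {R : realType} (S : mstate R) : Prop :=
  [/\ nneg2 (r0 S), nneg2 (r1 S) & nneg2 (r2 S)].

Definition interior_state {R : realType} (S : mstate R) : Prop :=
  [/\ pos2 (r0 S), pos2 (r1 S) & pos2 (r2 S)].

Definition reachable {R : realType} (phi u1 u2 : R * R -> R)
    (Sin : mstate R) : set (mstate R) :=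
  [set S | is_market_state S /\
    [/\ r0 S + r1 S + r2 S = r0 Sin + r1 Sin + r2 Sin,
        phi (r0 S) = phi (r0 Sin),
        u1 (r1 Sin) <= u1 (r1 S) &
        u2 (r2 Sin) <= u2 (r2 S)]].

(* The trade h moves the CFMM inventory q to q + h and the trader's holding r
   to r - h. *)
Definition valid_trade {R : realType} (phi : R * R -> R) (q r h : R * R) : Prop :=
  [/\ nneg2 (q + h), phi (q + h) = phi q & nneg2 (r - h)].

Definition unilateral_equilibrium {R : realType} (phi u1 u2 : R * R -> R)
    (S : mstate R) : Prop :=
  [/\ is_market_state S,
      ~ (exists h, valid_trade phi (r0 S) (r1 S) h /\
                   u1 (r1 S) < u1 (r1 S - h)) &
      ~ (exists h, valid_trade phi (r0 S) (r2 S) h /\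
                   u2 (r2 S) < u2 (r2 S - h))].

Definition weak_representative {R : realType} (phi uA : R * R -> R)
    (Sin S : mstate R) : Prop :=
  let rA := r1 Sin + r2 Sin in
  let hstar := r0 S - r0 Sin in
  valid_trade phi (r0 Sin) rA hstar /\
  forall h, valid_trade phi (r0 Sin) rA h -> uA (rA - h) <= uA (rA - hstar).

Definition strong_representative {R : realType} (phi u1 u2 uA : R * R -> R) :
    Prop :=
  forall Sin S : mstate R, interior_state Sin ->
    reachable phi u1 u2 Sin S -> unilateral_equilibrium phi u1 u2 S ->
    weak_representative phi uA Sin S.

(* Main.v *)
(* (ii) => (iii): letting the second level tend to 0, the curves f # g_c of Lambda_v
   (# is the infimal convolution) decrease to f, so v is constant on every level
   curve f of u1; thus u1, and likewise u2, is equivalent to v.  Convexity of f turns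
   f # ... # f (n times) into n f(./n), so the common family of level curves is stable
   under integer, hence by monotonicity under real, dilations.
   (iii) => (ii): every level curve is a f(./a) for one fixed curve f, and
   a f(./a) # b f(./b) = (a + b) f(./(a + b)).
   (iii) => (i): at an equilibrium all three holdings are supported by the same price,
   so homotheticity puts those of the two agents on one ray; their sum is then
   supported by that price, which separates it from the CFMM curve.
   (i) => (iii): if u1 at z1 and u2 at z2 have the price p, an inventory with price p
   makes an equilibrium, so v has the price p at z1 + z2.  Letting z2 tend to 0, v has
   the same price as u1 and u2 everywhere; equal prices force equal level curves, and
   additivity makes the price invariant under integer dilations. *)
Require Import Defs.
From mathcomp Require Import all_boot all_order all_algebra.
From mathcomp Require Import all_classical all_reals all_analysis.
From mathcomp Require Import ring lra.

Set Implicit Arguments.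
Unset Strict Implicit.
Unset Printing Implicit Defensive.

Import Order.TTheory GRing.Theory Num.Theory.
Import numFieldNormedType.Exports.

Local Open Scope classical_set_scope.
Local Open Scope ring_scope.

(** * Monotonicity and level points *)

(** Continuity of [u] is only relative to the closed quadrant. On a segment inside it, possibly with
    ends on the axes, the one-variable intermediate and extreme value theorems become available. *)
Lemma segment_continuous (R : realType) (u : R * R -> R) (p d : R * R) (a b : R) :
  propI u -> (forall t, a <= t <= b -> nneg2 (p + t *: d)) ->
  {within `[a, b], continuous (fun t => u (p + t *: d))}.
Proof.
move=> [cu _ _ _ _] H; apply/subspace_continuousP => t Ht.
move/subspace_continuousP: cu => /(_ (p + t *: d) (H t Ht)) cu.
apply: (@cvg_comp _ _ _ (fun s : R => p + s *: d) u _ _ _ _ cu).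
have cl : (p + s *: d) @[s --> t] --> p + t *: d.
  by apply: cvgD; [exact: cvg_cst|apply: cvgZr_tmp; exact: cvg_id].
move=> A /cl cA.
have {}cA : \forall s \near t, nneg2 (p + s *: d) -> A (p + s *: d) by exact: cA.
suff : \forall s \near t, `[a, b]%classic s -> A (p + s *: d) by [].
by apply: filterS cA => s As sab; apply: As; exact: H.
Qed.

Lemma level_on_segment (R : realType) (u : R * R -> R) (p d : R * R) (T c : R) :
  propI u -> 0 <= T -> (forall t, 0 <= t <= T -> nneg2 (p + t *: d)) ->
  u p < c -> c < u (p + T *: d) ->
  exists2 t, 0 < t < T & u (p + t *: d) = c.
Proof.
move=> hI T0 H lo hi.
have lo0 : u (p + 0 *: d) < c by rewrite scale0r addr0.
have [|t] := IVT T0 (segment_continuous hI H) (v := c).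
  by rewrite ge_min le_max (ltW lo0) (ltW hi) orbT.
rewrite in_itv /= => /andP[t0 tT] ut; exists t => //.
rewrite !lt_neqAle t0 tT !andbT; apply/andP; split; apply/eqP => E.
  by move: lo0; rewrite E ut ltxx.
by move: hi; rewrite -E ut ltxx.
Qed.

Lemma utility_gt0 (R : realType) (u : R * R -> R) (x y : R) :
  satisfies_I_IV u -> 0 < x -> 0 < y -> 0 < u (x, y).
Proof.
move=> [pu [_ _ u0 ux _] _ _ _] x0 y0; rewrite -(u0 y (ltW y0)).
have h : 0 < x / 2 < x by lra.
case/andP: h => h h'.
rewrite u0 ?ltW//; apply: le_lt_trans (ux _ _ _ h y0 h').
by apply: pu; split => /=; exact: ltW.
Qed.

Lemma utility_le (R : realType) (u : R * R -> R) (x y x' y' : R) :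
  satisfies_I_IV u -> 0 < x -> 0 < y -> x <= x' -> y <= y' ->
  u (x, y) <= u (x', y').
Proof.
move=> [_ [_ _ _ ux uy] _ _ _] x0 y0.
rewrite le_eqVlt => /orP[/eqP<-|xx']; rewrite le_eqVlt => /orP[/eqP<-|yy'] //.
- exact/ltW/uy.
- exact/ltW/ux.
- by apply/ltW/(lt_trans (ux _ _ _ x0 y0 xx'))/uy => //; exact: lt_trans xx'.
Qed.

Lemma utility_lt2 (R : realType) (u : R * R -> R) (x y x' y' : R) :
  satisfies_I_IV u -> 0 < x -> 0 < y -> x <= x' -> y < y' ->
  u (x, y) < u (x', y').
Proof.
move=> hu x0 y0 xx' yy'.
apply: lt_le_trans (_ : u (x, y') <= _).
  by case: hu => _ [_ _ _ _ uy] _ _ _; exact: uy.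
by apply: utility_le => //; exact: lt_trans yy'.
Qed.

Lemma utility_ltl2 (R : realType) (u : R * R -> R) (x y y' : R) :
  satisfies_I_IV u -> 0 < x -> 0 < y -> 0 < y' ->
  u (x, y) < u (x, y') -> y < y'.
Proof.
by move=> hu x0 y0 y'0; apply: contraTlt => y'y; rewrite -leNgt utility_le.
Qed.

Lemma utility_lel2 (R : realType) (u : R * R -> R) (x y y' : R) :
  satisfies_I_IV u -> 0 < x -> 0 < y -> 0 < y' ->
  u (x, y) <= u (x, y') -> y <= y'.
Proof.
by move=> hu x0 y0 y'0; apply: contraTle => y'y; rewrite -ltNge utility_lt2.
Qed.

Lemma utility_inj2 (R : realType) (u : R * R -> R) (x y y' : R) :
  satisfies_I_IV u -> 0 < x -> 0 < y -> 0 < y' ->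
  u (x, y) = u (x, y') -> y = y'.
Proof.
move=> hu x0 y0 y'0 E.
by apply/eqP; rewrite eq_le; apply/andP; split;
  apply: (utility_lel2 hu x0) => //; rewrite E.
Qed.

Lemma utility_off_pos2 (R : realType) (u : R * R -> R) (z : R * R) :
  satisfies_I_IV u -> nneg2 z -> ~ pos2 z -> u z = 0.
Proof.
case: z => x y [_ [_ u0 u0' _ _] _ _ _] [/= x0 y0] h.
move: x0; rewrite le_eqVlt => /predU1P[<-|x0]; first exact: u0'.
move: y0; rewrite le_eqVlt => /predU1P[<-|y0]; first by apply: u0; exact: ltW.
by case: h.
Qed.

Lemma utility_gt0_pos2 (R : realType) (u : R * R -> R) (z : R * R) :
  satisfies_I_IV u -> nneg2 z -> 0 < u z -> pos2 z.
Proof.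
move=> hu hz uz; have [//|nz] := pselect (pos2 z).
by move: uz; rewrite (utility_off_pos2 hu hz nz) ltxx.
Qed.

Lemma vertical_point (R : realType) (u : R * R -> R) (x y c : R) :
  satisfies_I_IV u -> 0 < x -> 0 < y -> 0 < c -> c < u (x, y) ->
  exists2 y', 0 < y' < y & u (x, y') = c.
Proof.
move=> [_ hI _ _ _] x0 y0 c0 cu.
have E t : (x, 0) + t *: (0, 1) = (x, t).
  by congr pair; rewrite /= /GRing.scale /= ?mulr0 ?addr0 ?mulr1 ?add0r.
have [||||y' hy] := @level_on_segment _ u (x, 0) (0, 1) y c hI.
- exact: ltW.
- by move=> t /andP[t0 _]; rewrite E; split => //=; exact: ltW.
- by case: hI => _ -> //; exact: ltW.
- by rewrite E.
by rewrite E; exists y'.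
Qed.

Lemma horizontal_point (R : realType) (u : R * R -> R) (x y c : R) :
  satisfies_I_IV u -> 0 < x -> 0 < y -> 0 < c -> c < u (x, y) ->
  exists2 x', 0 < x' < x & u (x', y) = c.
Proof.
move=> [_ hI _ _ _] x0 y0 c0 cu.
have E t : (0, y) + t *: (1, 0) = (t, y).
  by congr pair; rewrite /= /GRing.scale /= ?mulr0 ?addr0 ?mulr1 ?add0r.
have [||||x' hx] := @level_on_segment _ u (0, y) (1, 0) x c hI.
- exact: ltW.
- by move=> t /andP[t0 _]; rewrite E; split => //=; exact: ltW.
- by case: hI => _ _ -> //; exact: ltW.
- by rewrite E.
by rewrite E; exists x'.
Qed.

Lemma utility_unbounded (R : realType) (u : R * R -> R) (x c : R) :
  satisfies_I_IV u -> 0 < x -> exists2 y, 0 < y & c < u (x, y).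
Proof.
move=> [_ _ [_ h] _ _] x0; have /cvgryPgt/(_ c) h1 := h x x0.
have h2 : \forall y \near pinfty_nbhs R, 0 < y by exact: nbhs_pinfty_gt.
by have [y [? ?]] := filter_ex (filterI h2 h1); exists y.
Qed.

Lemma level_point (R : realType) (u : R * R -> R) (x c : R) :
  satisfies_I_IV u -> 0 < x -> 0 < c -> exists2 y, 0 < y & u (x, y) = c.
Proof.
move=> hu x0 c0; have [y y0 cy] := utility_unbounded c hu x0.
by have [y' /andP[y'0 _] E] := vertical_point hu x0 y0 c0 cy; exists y'.
Qed.

(** Every positive level meets the diagonal, so diagonal points serve below as canonical
    representatives of indifference classes. *)
Lemma diagonal_point (R : realType) (u : R * R -> R) (c : R) :
  satisfies_I_IV u -> 0 < c -> exists2 t, 0 < t & u (t, t) = c.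
Proof.
move=> hu c0; have [y y0 cy] := utility_unbounded c hu (@ltr01 R).
have hI : propI u by case: hu.
have E t : (0, 0) + t *: (1, 1) = (t, t) :> R * R.
  by congr pair; rewrite /= /GRing.scale /= ?mulr1 ?add0r.
(* The diagonal point with parameter [Num.max 1 y] dominates [(1, y)], whose value already exceeds
   [c]. *)
have T0 : 0 <= Num.max 1 y by rewrite le_max ler01.
have [|||t /andP[t0 _]] := @level_on_segment _ u (0, 0) (1, 1) _ c hI T0.
- by move=> t /andP[t0 _]; rewrite E; split.
- by case: hI => _ ->.
- rewrite E; apply: lt_le_trans cy _; apply: utility_le => //.
    by rewrite le_max lexx.
  by rewrite le_max lexx orbT.
by rewrite E; exists t.
Qed.

Lemma diagonal_lt (R : realType) (u : R * R -> R) (s t : R) :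
  satisfies_I_IV u -> 0 < s -> 0 < t -> (u (s, s) < u (t, t)) = (s < t).
Proof.
move=> hu s0 t0; have [st|ts] := ltP s t.
  by apply: utility_lt2 => //; exact: ltW.
by apply/negbTE; rewrite -leNgt utility_le.
Qed.

Lemma diagonal_le (R : realType) (u : R * R -> R) (s t : R) :
  satisfies_I_IV u -> 0 < s -> 0 < t -> (u (s, s) <= u (t, t)) = (s <= t).
Proof. by move=> hu s0 t0; rewrite !leNgt diagonal_lt. Qed.

(** * Prices and supporting lines *)

Lemma directional_cvg (R : realType) (u : R * R -> R) (z e : R * R) :
  differentiable u z ->
  t^-1 * (u (z + t *: e) - u z) @[t --> 0^'+] --> e.1 * dx u z + e.2 * dy u z.
Proof.
move=> du.
have -> : e.1 * dx u z + e.2 * dy u z = 'D_e u z.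
  rewrite /dx /dy !deriveE // -2!linearZ -linearD.
  by congr ('d u z _); case: e => a b; congr pair;
    rewrite /= /GRing.scale /= ?mulr1 ?mulr0 ?addr0 ?add0r.
have /cvg_ex[l] := @diff_derivable _ _ _ _ _ e du.
move=> hl; have -> : 'D_e u z = l by apply: cvg_lim hl.
apply: cvg_trans (cvg_dnbhs_at_right hl).
by apply: near_eq_cvg; near=> t; rewrite /= [z + _]addrC.
Unshelve. all: by end_near. Qed.

Lemma directional_ascent (R : realType) (u : R * R -> R) (z e : R * R) :
  differentiable u z -> 0 < e.1 * dx u z + e.2 * dy u z ->
  \forall t \near 0^'+, u z < u (z + t *: e).
Proof.
move=> du D0; have := cvgr_gt _ (directional_cvg du) _ D0.
move=> h; near=> t.
have t0 : 0 < t by near: t; exact: nbhs_right_gt.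
have : 0 < t^-1 * (u (z + t *: e) - u z) by near: t; exact: h.
by rewrite pmulr_rgt0 ?invr_gt0// subr_gt0.
Unshelve. all: by end_near. Qed.

(** By concavity every difference quotient from [z] towards [z'] is at least [u z' - u z]; the bound
    survives the limit. *)
Lemma concave_le_grad (R : realType) (u : R * R -> R) (z z' : R * R) :
  satisfies_I_IV u -> pos2 z -> pos2 z' ->
  u z' - u z <= (z'.1 - z.1) * dx u z + (z'.2 - z.2) * dy u z.
Proof.
move=> [_ _ _ [du cu] _] hz hz'.
have [->|zz'] := eqVneq z' z; first by rewrite !subrr !mul0r addr0.
have [dz _ _] := du z hz.
apply: cvgr_to_ge (@directional_cvg _ u z (z' - z) dz) _.
near=> t.
have t0 : 0 < t by near: t; exact: nbhs_right_gt.
have t1 : t < 1 by near: t; exact: nbhs_right_lt.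
have := cu z' z t hz' hz zz' t0 t1.
have -> : t *: z' + (1 - t) *: z = z + t *: (z' - z).
  by rewrite scalerBl scale1r scalerBr addrCA.
by move=> h; rewrite ler_pdivlMl//; lra.
Unshelve. all: by end_near. Qed.

(** The strictness lost in the limit is recovered at the midpoint: the weak bound is applied there,
    and strict concavity puts its value above the average. *)
Lemma concave_lt_grad (R : realType) (u : R * R -> R) (z z' : R * R) :
  satisfies_I_IV u -> pos2 z -> pos2 z' -> z' != z ->
  u z' - u z < (z'.1 - z.1) * dx u z + (z'.2 - z.2) * dy u z.
Proof.
move=> hu hz hz' zz'; have [_ _ _ [_ cu] _] := hu.
have h2 : 0 < 2^-1 :> R by rewrite invr_gt0 ltr0n.
have h2' : 2^-1 < 1 :> R by rewrite invf_lt1 ?ltr1n ?ltr0n.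
have hm : pos2 (2^-1 *: z' + (1 - 2^-1) *: z).
  case: z z' hz hz' {zz'} => [x y] [x' y'] [/= ? ?] [/= ? ?].
  by split; rewrite /= /GRing.scale /=; lra.
have := cu z' z _ hz' hz zz' h2 h2'.
have := concave_le_grad hu hz hm.
set m := _ *: z' + _; have -> : m.1 - z.1 = 2^-1 * (z'.1 - z.1).
  by rewrite /m /= /GRing.scale /=; ring.
have -> : m.2 - z.2 = 2^-1 * (z'.2 - z.2).
  by rewrite /m /= /GRing.scale /=; ring.
by lra.
Qed.

(** By concavity the derivative dominates the increment over a unit step, which is positive by
    strict monotonicity. *)
Lemma dx_gt0 (R : realType) (u : R * R -> R) (z : R * R) :
  satisfies_I_IV u -> pos2 z -> 0 < dx u z.
Proof.
case: z => x y hu hz; have [x0 y0] := hz.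
have x1 : x < x + 1 by rewrite ltrDl.
have hz' : pos2 (x + 1, y) by split => //=; exact: lt_trans x1.
have := concave_le_grad hu hz hz' => /=.
have [_ [_ _ _ /(_ _ _ _ x0 y0 x1) h _] _ _ _] := hu.
by rewrite subrr mul0r; lra.
Qed.

Lemma dy_gt0 (R : realType) (u : R * R -> R) (z : R * R) :
  satisfies_I_IV u -> pos2 z -> 0 < dy u z.
Proof.
case: z => x y hu hz; have [x0 y0] := hz.
have y1 : y < y + 1 by rewrite ltrDl.
have hz' : pos2 (x, y + 1) by split => //=; exact: lt_trans y1.
have := concave_le_grad hu hz hz' => /=.
have [_ [_ _ _ _ /(_ _ _ _ x0 y0 y1) h] _ _ _] := hu.
by rewrite subrr mul0r; lra.
Qed.

Lemma price_gt0 (R : realType) (u : R * R -> R) (z : R * R) :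
  satisfies_I_IV u -> pos2 z -> 0 < price u z.
Proof. by move=> hu hz; rewrite divr_gt0 ?dx_gt0 ?dy_gt0. Qed.

Lemma dx_price (R : realType) (u : R * R -> R) (z : R * R) :
  satisfies_I_IV u -> pos2 z -> dx u z = price u z * dy u z.
Proof. by move=> hu hz; rewrite /price divfK// gt_eqF// dy_gt0. Qed.

Lemma price_supergradient (R : realType) (u : R * R -> R) (z z' : R * R) :
  satisfies_I_IV u -> pos2 z -> pos2 z' ->
  u z' - u z <= dy u z * (price u z * (z'.1 - z.1) + (z'.2 - z.2)).
Proof.
move=> hu hz hz'; apply: le_trans (concave_le_grad hu hz hz') _.
by rewrite dx_price//; lra.
Qed.

Lemma price_supports (R : realType) (u : R * R -> R) (z z' : R * R) :
  satisfies_I_IV u -> pos2 z -> nneg2 z' -> z' != z ->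
  price u z * z'.1 + z'.2 <= price u z * z.1 + z.2 -> u z' < u z.
Proof.
move=> hu hz hz' zz' hp.
have [hz2|nz2] := pselect (pos2 z'); last first.
  rewrite (utility_off_pos2 hu hz' nz2).
  by case: z hz {hp zz'} => x y [? ?]; exact: utility_gt0.
have := concave_lt_grad hu hz hz2 zz'.
rewrite dx_price// => h; rewrite -subr_lt0; apply: lt_le_trans h _.
rewrite (_ : _ + _ = dy u z * (price u z * z'.1 + z'.2 - (price u z * z.1 + z.2))).
  by rewrite pmulr_rle0 ?dy_gt0// subr_le0.
by ring.
Qed.

Lemma near_segment_pos2 (R : realType) (z e : R * R) :
  pos2 z -> \forall t \near 0^'+, pos2 (z + t *: e).
Proof.
move=> [z1 z2].
have H (a b : R) : 0 < a -> \forall t \near 0^'+, 0 < a + t * b.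
  move=> a0; have : a + t * b @[t --> 0^'+] --> a.
    apply: cvg_at_right_filter; rewrite -[X in _ --> X]addr0 -[X in _ --> _ + X](mul0r b).
    by apply: cvgD; [exact: cvg_cst|apply: cvgMl; exact: cvg_id].
  by move=> /cvgr_gt; exact.
by apply: filterS2 (H _ e.1 z1) (H _ e.2 z2).
Qed.

(** If the prices differ, trading at a rate between them raises both [phi] and [u]; returning the
    surplus of [phi] to the agent gives a valid improving trade. *)
Lemma tangency (R : realType) (phi u : R * R -> R) (a b : R * R) :
  satisfies_I_IV phi -> satisfies_I_IV u -> pos2 a -> pos2 b ->
  ~ (exists h, valid_trade phi a b h /\ u b < u (b - h)) ->
  price phi a = price u b.
Proof.
move=> hphi hu ha hb; apply: contra_notP => /eqP pq.
have [_ _ _ [/(_ a ha)[dphi _ _] _] _] := hphi.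
have [_ _ _ [/(_ b hb)[du _ _] _] _] := hu.
set p := price phi a in pq; set q := price u b in pq.
have pq2 : 0 < (p - q) ^+ 2 by rewrite exprn_even_gt0//= subr_eq0.
(* The exchange rate of [e] is the mean of the two prices, and the factor [p - q] orients it so that
   [phi] grows along [e] and [u] along [- e]. *)
pose e := (p - q, - ((p - q) * (p + q) / 2)).
have ephi : 0 < e.1 * dx phi a + e.2 * dy phi a.
  rewrite dx_price// -/p /=.
  rewrite (_ : _ + _ = dy phi a * ((p - q) ^+ 2 / 2)); last by field.
  by rewrite mulr_gt0 ?dy_gt0 ?divr_gt0.
have eu : 0 < (- e).1 * dx u b + (- e).2 * dy u b.
  rewrite dx_price// -/q /=.
  rewrite (_ : _ + _ = dy u b * ((p - q) ^+ 2 / 2)); last by field.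
  by rewrite mulr_gt0 ?dy_gt0 ?divr_gt0.
have [t [[[at0 bt0] phit] ut]] := filter_ex (filterI (filterI (filterI
  (near_segment_pos2 e ha) (near_segment_pos2 (- e) hb))
  (directional_ascent dphi ephi)) (directional_ascent du eu)).
have phia : 0 < phi a by case: (a) ha => x y [? ?]; exact: utility_gt0.
(* Lowering the second coordinate brings the inventory back to the level of [phi a]; what is taken
   off goes to the agent, who thus ends at least as well off as at [b - t *: e]. *)
have [y' /andP[y'0 y't] E] := vertical_point hphi at0.1 at0.2 phia phit.
have Ea : a + (t * e.1, y' - a.2) = (a.1 + t * e.1, y').
  by case: (a) => x y; congr pair => /=; rewrite addrCA subrr addr0.
exists (t * e.1, y' - a.2); split.
  split; first by rewrite Ea; split; apply: ltW => //; exact: at0.1.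
    by rewrite Ea.
  split => /=.
    by have [+ _] := bt0; rewrite /= /GRing.scale /=; lra.
  have [_] := bt0; rewrite /= /GRing.scale /=.
  by move: y't; rewrite /= /GRing.scale /=; lra.
apply: lt_le_trans ut _.
have -> : b - (t * e.1, y' - a.2) = (b.1 - t * e.1, b.2 - (y' - a.2)) by [].
have -> : b + t *: - e = (b.1 - t * e.1, b.2 - t * e.2).
  by congr pair; rewrite /= /GRing.scale /= mulrN.
have [bt1 bt2] := bt0.
apply: utility_le => //.
- by move: bt1; rewrite /= /GRing.scale /= mulrN.
- by move: bt2; rewrite /= /GRing.scale /= mulrN.
- by move: y't; rewrite /= /GRing.scale /=; lra.
Qed.

Lemma budget_max_price (R : realType) (u : R * R -> R) (z : R * R) (p : R) :
  satisfies_I_IV u -> pos2 z ->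
  (forall z', pos2 z' -> p * z'.1 + z'.2 = p * z.1 + z.2 -> u z' <= u z) ->
  price u z = p.
Proof.
move=> hu hz hmax; apply/eqP/negPn/negP => pq.
have [_ _ _ [/(_ z hz)[du _ _] _] _] := hu.
set q := price u z in pq.
(* This direction keeps the budget [p * z.1 + z.2] fixed and is oriented so that [u] increases. *)
pose e := (q - p, - ((q - p) * p)).
have ez : 0 < e.1 * dx u z + e.2 * dy u z.
  rewrite dx_price// -/q /=.
  rewrite (_ : _ + _ = dy u z * ((q - p) ^+ 2)); last by ring.
  by rewrite mulr_gt0 ?dy_gt0// exprn_even_gt0//= subr_eq0.
have [t [zt]] := filter_ex (filterI (near_segment_pos2 e hz) (directional_ascent du ez)).
rewrite ltNge hmax//; rewrite /= /GRing.scale /=; ring.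
Qed.

Lemma price_on_budget (R : realType) (u : R * R -> R) (p m : R) :
  satisfies_I_IV u -> 0 < p -> 0 < m ->
  exists z, [/\ pos2 z, p * z.1 + z.2 = m & price u z = p].
Proof.
move=> hu p0 m0; have hI : propI u by case: hu.
have mp0 : 0 < m / p by rewrite divr_gt0.
have E t : (0, m) + t *: (1, - p) = (t, m - p * t).
  by congr pair; rewrite /= /GRing.scale /= ?mulr1 ?add0r// mulrN mulrC.
have inside t : 0 <= t <= m / p -> nneg2 ((0, m) + t *: (1, - p)).
  move=> /andP[t0 tm]; rewrite E; split => //=.
  by rewrite subr_ge0 mulrC -ler_pdivlMr.
have [t tm tmax] := EVT_max (ltW mp0) (segment_continuous hI inside).
have hz : pos2 (t, m - p * t).
  have hn := inside t tm; rewrite E in hn.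
  apply: (utility_gt0_pos2 hu hn).
  (* The midpoint of the budget segment has positive utility, whereas [u] vanishes at the ends;
     hence the maximizer is interior. *)
  have hm : m / p / 2 \in `[0, m / p] by rewrite in_itv /=; lra.
  have := tmax _ hm; rewrite !E; apply: lt_le_trans.
  apply: utility_gt0 => //; first by rewrite divr_gt0.
  rewrite (_ : p * _ = m / 2); last by field; rewrite gt_eqF.
  by lra.
exists (t, m - p * t); split => //; first by rewrite /= addrC subrK.
apply: budget_max_price => // -[x y] [x0 y0] /= Exy.
have -> : y = m - p * x by lra.
have := tmax x; rewrite !E; apply.
by rewrite in_itv /= (ltW x0) /= ler_pdivlMr// mulrC; move: (y0 : 0 < y); lra.
Qed.

(** * Equivalence and homotheticity *)

Lemma pos2_nneg2 (R : realType) (z : R * R) : pos2 z -> nneg2 z.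
Proof. by move=> [? ?]; split; exact: ltW. Qed.

Lemma pos2_scale (R : realType) (k : R) (z : R * R) : 0 < k -> pos2 z -> pos2 (k *: z).
Proof. by move=> k0 [? ?]; split; exact: mulr_gt0. Qed.

Lemma pos2_add (R : realType) (z z' : R * R) : pos2 z -> pos2 z' -> pos2 (z + z').
Proof. by move=> [? ?] [? ?]; split; exact: addr_gt0. Qed.

Lemma diagonal_inj (R : realType) (u : R * R -> R) (s t : R) :
  satisfies_I_IV u -> 0 < s -> 0 < t -> u (s, s) = u (t, t) -> s = t.
Proof.
move=> hu s0 t0 E; apply/eqP.
by rewrite eq_le -(diagonal_le hu s0 t0) -(diagonal_le hu t0 s0) E lexx.
Qed.

Lemma diagonal_representative (R : realType) (u : R * R -> R) (z : R * R) :
  satisfies_I_IV u -> pos2 z -> exists2 t, 0 < t & u (t, t) = u z.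
Proof.
by case: z => x y hu [x0 y0]; apply: diagonal_point => //; exact: utility_gt0.
Qed.

(** Constancy of [v] on the indifference classes of [u] moves every comparison to the diagonal,
    where both functions order points by their parameter. The conditions on [v] are listed one by
    one so that they also cover [diagonal_utility]. *)
Lemma diagonal_equivalent (R : realType) (u v : R * R -> R) :
  satisfies_I_IV u ->
  (forall z, nneg2 z -> ~ pos2 z -> v z = 0) ->
  (forall z, pos2 z -> 0 < v z) ->
  (forall s t, 0 < s -> 0 < t -> (v (s, s) <= v (t, t)) = (s <= t)) ->
  (forall z z', pos2 z -> pos2 z' -> u z = u z' -> v z = v z') ->
  equivalent u v.
Proof.
move=> hu v0 vpos vdiag uv r r' hr hr'.
have u_gt0 z : pos2 z -> 0 < u z by case: z => x y [? ?]; exact: utility_gt0.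
have [pr'|nr'] := pselect (pos2 r'); last first.
  rewrite (v0 r')// (utility_off_pos2 hu hr' nr').
  have [pr|nr] := pselect (pos2 r); first by rewrite !ltW ?vpos ?u_gt0.
  by rewrite (v0 r)// (utility_off_pos2 hu hr nr) !lexx.
have [pr|nr] := pselect (pos2 r); last first.
  by rewrite (v0 r)// (utility_off_pos2 hu hr nr) !leNgt vpos ?u_gt0.
have [t t0 Et] := diagonal_representative hu pr.
have [t' t'0 Et'] := diagonal_representative hu pr'.
rewrite -(uv (t, t) r)// -(uv (t', t') r')// -Et -Et'.
by rewrite vdiag// diagonal_le.
Qed.

Lemma indifference_equivalent (R : realType) (u v : R * R -> R) :
  satisfies_I_IV u -> satisfies_I_IV v ->
  (forall z z', pos2 z -> pos2 z' -> u z = u z' -> v z = v z') ->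
  equivalent u v.
Proof.
move=> hu hv; apply: diagonal_equivalent => //.
- by move=> z; exact: utility_off_pos2.
- by move=> [x y] [? ?]; exact: utility_gt0.
- by move=> s t; exact: diagonal_le.
Qed.

Lemma equivalent_sym (R : realType) (u v : R * R -> R) :
  equivalent u v -> equivalent v u.
Proof. by move=> uv r r' hr hr'; split=> /(uv r r' hr hr'). Qed.

Lemma equivalent_trans (R : realType) (u v w : R * R -> R) :
  equivalent u v -> equivalent v w -> equivalent u w.
Proof.
move=> uv vw r r' hr hr'; split => [/(uv r r' hr hr')/(vw r r' hr hr')//|].
by move=> /(vw r r' hr hr')/(uv r r' hr hr').
Qed.

Lemma equivalent_indifference (R : realType) (u v : R * R -> R) (z z' : R * R) :
  equivalent u v -> nneg2 z -> nneg2 z' -> u z = u z' -> v z = v z'.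
Proof.
move=> uv hz hz' E; apply/le_anti/andP.
by split; apply/uv; rewrite ?E.
Qed.

Lemma equivalent_homothetic (R : realType) (u v : R * R -> R) :
  equivalent u v -> represents_homothetic v -> represents_homothetic u.
Proof.
move=> uv [w [w0 hw vw]]; exists w; split => //; exact: equivalent_trans vw.
Qed.

Lemma homothetic_scale_le (R : realType) (u : R * R -> R) (k : R) (z z' : R * R) :
  represents_homothetic u -> 0 < k -> pos2 z -> pos2 z' ->
  u z <= u z' -> u (k *: z) <= u (k *: z').
Proof.
case: z z' => [x y] [x' y'] [w [_ hw uw]] k0 hz hz'.
have [? ? ? ?] : [/\ nneg2 (x, y), nneg2 (x', y'),
    nneg2 (k *: (x, y)) & nneg2 (k *: (x', y'))].
  by split; apply: pos2_nneg2 => //; exact: pos2_scale.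
move=> /uw h; apply/uw => //; rewrite -![_ *: _]/(_ * _, _ * _).
case: hz hz' => [? ?] [? ?].
by rewrite !hw// ler_pM2l// h.
Qed.

Lemma homothetic_scale_eq (R : realType) (u : R * R -> R) (k : R) (z z' : R * R) :
  represents_homothetic u -> 0 < k -> pos2 z -> pos2 z' ->
  u z = u z' -> u (k *: z) = u (k *: z').
Proof.
by move=> hh k0 hz hz' E; apply/le_anti; rewrite !homothetic_scale_le// E.
Qed.

Lemma exists_ratio_between (R : realType) (a b : R) :
  0 <= a -> a < b -> exists n m : nat, a < n.+1%:R / m.+1%:R < b.
Proof.
move=> a0 ab; pose m := Num.truncn (b - a)^-1.
pose n := Num.truncn (a * m.+1%:R).
have ba : 0 < b - a by rewrite subr_gt0.
have m1 : (b - a)^-1 < m.+1%:R by exact: truncnS_gt.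
have am : 0 <= a * m.+1%:R by rewrite mulr_ge0.
have /andP[n1 n2] := truncn_itv am.
exists n, m; rewrite ltr_pdivlMr// ltr_pdivrMr//; apply/andP; split => //.
have : 1 < m.+1%:R * (b - a) by rewrite -ltr_pdivrMr// div1r.
rewrite -/n in n1 n2.
by rewrite -[n.+1]addn1 natrD; lra.
Qed.

(** The candidate homogeneous representative of [u]: the parameter at which the indifference curve
    through [z] crosses the diagonal. Off the open quadrant the set is empty and the default 0
    agrees with the vanishing of [u] on the axes. *)
Definition diagonal_utility {R : realType} (u : R * R -> R) (z : R * R) : R :=
  xget 0 [set t | [/\ pos2 z, 0 < t & u (t, t) = u z]].

Lemma diagonal_utilityP (R : realType) (u : R * R -> R) (z : R * R) :
  satisfies_I_IV u -> pos2 z ->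
  0 < diagonal_utility u z /\
  u (diagonal_utility u z, diagonal_utility u z) = u z.
Proof.
move=> hu hz; rewrite /diagonal_utility; case: xgetP => [t _ []//|].
by have [t t0 E] := diagonal_representative hu hz => /(_ t) []; split.
Qed.

Lemma diagonal_utility_off (R : realType) (u : R * R -> R) (z : R * R) :
  ~ pos2 z -> diagonal_utility u z = 0.
Proof. by move=> nz; rewrite /diagonal_utility xgetPN// => t [/nz]. Qed.

(** Stability of indifference under integer dilations extends to rational ones by undoing a
    dilation, then to real ones by monotonicity along rays; this makes [diagonal_utility u]
    homogeneous. *)
Lemma homothetic_of_nat_scale (R : realType) (u : R * R -> R) :
  satisfies_I_IV u ->
  (forall (n : nat) z z', pos2 z -> pos2 z' -> u z = u z' ->
     u (n.+1%:R *: z) = u (n.+1%:R *: z')) ->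
  represents_homothetic u.
Proof.
move=> hu hn.
have hd (t : R) : 0 < t -> pos2 (t, t) by [].
(* To divide by [m.+1], the contracted point is replaced by an indifferent diagonal point [(s, s)];
   dilating back identifies [s] as [t / m.+1]. *)
have hrat (n m : nat) z (t : R) : pos2 z -> 0 < t -> u z = u (t, t) ->
    u ((n.+1%:R / m.+1%:R) *: z) =
    u (n.+1%:R / m.+1%:R * t, n.+1%:R / m.+1%:R * t).
  move=> hz t0 E; set k : R := m.+1%:R.
  have k0 : 0 < k by rewrite ltr0n.
  have ki0 : 0 < k^-1 by rewrite invr_gt0.
  have hz' := pos2_scale ki0 hz.
  have [s s0 Es] := diagonal_representative hu hz'.
  have := hn m _ _ (hd s s0) hz' Es.
  rewrite -/k scalerA divff ?gt_eqF// scale1r E => Et.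
  have {}Et : k * s = t by apply: (diagonal_inj hu) => //; exact: mulr_gt0.
  rewrite -scalerA -(hn n _ _ (hd s s0) hz' Es) -Et.
  by congr (u (_, _)); rewrite mulrA divfK// gt_eqF.
have hreal k z t : 0 < k -> pos2 z -> 0 < t -> u z = u (t, t) ->
    u (k *: z) = u (k * t, k * t).
  move=> k0 hz t0 E; have kt0 := mulr_gt0 k0 t0.
  have hz' := pos2_scale k0 hz.
  have [s s0 Es] := diagonal_representative hu hz'.
  have mono q r : 0 < q -> q <= r -> u (q *: z) <= u (r *: z).
    move=> q0 qr; have [z1 z2] := hz.
    case: (z) z1 z2 => x y /= x0 y0.
    by apply: utility_le => //; rewrite ?mulr_gt0// ler_pM2r.
  (* If [s / t] and [k] differ, a rational strictly between them contradicts [mono] together with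
     [hrat]. *)
  have [skt|kts|<- //] := ltgtP s (k * t).
  - have : s / t < k by rewrite ltr_pdivrMr.
    have st0 : 0 <= s / t by rewrite divr_ge0// ltW.
    move=> /(exists_ratio_between st0)[n [m /andP[sq qk]]].
    have q0 : 0 < n.+1%:R / m.+1%:R :> R by rewrite divr_gt0.
    have := mono _ _ q0 (ltW qk).
    rewrite (hrat n m z t)// -Es diagonal_le ?mulr_gt0//.
    by move: sq; rewrite ltr_pdivrMr// => /lt_le_trans/[apply]; rewrite ltxx.
  - have : k < s / t by rewrite ltr_pdivlMr.
    move=> /(exists_ratio_between (ltW k0))[n [m /andP[kq qs]]].
    have q0 : 0 < n.+1%:R / m.+1%:R :> R by rewrite divr_gt0.
    have := mono _ _ k0 (ltW kq).
    rewrite (hrat n m z t)// -Es diagonal_le ?mulr_gt0//.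
    by move: qs; rewrite ltr_pdivlMr// => /le_lt_trans/[apply]; rewrite ltxx.
exists (diagonal_utility u); split.
- move=> z _; have [hz|nz] := pselect (pos2 z); last by rewrite diagonal_utility_off.
  by rewrite ltW//; case: (diagonal_utilityP hu hz).
- move=> x y k x0 y0 k0.
  have hz : pos2 (x, y) by [].
  have [t0 Et] := diagonal_utilityP hu hz.
  have [s0 Es] := diagonal_utilityP hu (pos2_scale k0 hz).
  have := hreal k (x, y) _ k0 hz t0 (esym Et).
  by rewrite -Es => /(diagonal_inj hu); apply => //; exact: mulr_gt0.
- apply: diagonal_equivalent => //.
  + by move=> z _; exact: diagonal_utility_off.
  + by move=> z hz; case: (diagonal_utilityP hu hz).
  + have ddiag s : 0 < s -> diagonal_utility u (s, s) = s.
      move=> s0; have [t0 Et] := diagonal_utilityP hu (hd s s0).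
      exact: (diagonal_inj hu).
    by move=> s t s0 t0; rewrite !ddiag.
  + move=> z z' hz hz' E.
    have [t0 Et] := diagonal_utilityP hu hz.
    have [t'0 Et'] := diagonal_utilityP hu hz'.
    by apply: (diagonal_inj hu) => //; rewrite Et Et'.
Qed.

(** * Level curves and infimal convolution *)

Lemma posnum_gt0 (R : realType) (x : {posnum R}) : 0 < x%:num.
Proof. by []. Qed.

Definition on_level {R : realType} (u : R * R -> R) (c : R) (f : {posnum R} -> R) :=
  forall x, 0 < f x /\ u (x%:num, f x) = c.

(** A pointwise condition captures the whole level set: points of positive level are interior, and
    strict monotonicity leaves one of them above each abscissa. *)
Lemma LambdaP (R : realType) (u : R * R -> R) (f : {posnum R} -> R) :
  satisfies_I_IV u -> Lambda u f <-> exists2 c, 0 < c & on_level u c f.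
Proof.
move=> hu; split => -[c c0].
  move=> [f0 E]; exists c => // x; split => //.
  have : [set z | nneg2 z /\ u z = c] (x%:num, f x) by rewrite E; exists x.
  by case.
move=> hf; exists c => //; split; first by move=> x; case: (hf x).
apply/seteqP; split => [[x y] [hz E]|_ [x _ <-]] /=.
  have [/= x0 y0] : pos2 (x, y) by apply: (utility_gt0_pos2 hu hz); rewrite E.
  exists (PosNum x0) => //; congr pair.
  have [fx0 fxE] := hf (PosNum x0).
  by apply: (utility_inj2 hu x0) => //; rewrite E -fxE.
by have [fx0 fxE] := hf x; split => //; split => //=; exact: ltW.
Qed.

Lemma level_curve_exists (R : realType) (u : R * R -> R) (c : R) :
  satisfies_I_IV u -> 0 < c -> exists f, on_level u c f.
Proof.
move=> hu c0.
have /choice[f hf] : forall x : {posnum R}, exists y, 0 < y /\ u (x%:num, y) = c.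
  by move=> x; have [y y0 E] := level_point hu (posnum_gt0 x) c0; exists y.
by exists f.
Qed.

Lemma on_level_unique (R : realType) (u : R * R -> R) (c : R) f g :
  satisfies_I_IV u -> on_level u c f -> on_level u c g -> f = g.
Proof.
move=> hu hf hg; apply/funext => x.
have [fx0 fxE] := hf x; have [gx0 gxE] := hg x.
by apply: (utility_inj2 hu (posnum_gt0 x)) => //; rewrite gxE.
Qed.

Lemma on_level_pos2 (R : realType) (u : R * R -> R) (c : R) f (x : {posnum R}) :
  on_level u c f -> pos2 (x%:num, f x).
Proof. by move=> /(_ x)[? _]; split => /=. Qed.

Lemma Lambda_equivalent (R : realType) (u v : R * R -> R) :
  satisfies_I_IV u -> satisfies_I_IV v -> equivalent u v -> Lambda u = Lambda v.
Proof.
suff H (u' v' : R * R -> R) : satisfies_I_IV u' -> satisfies_I_IV v' ->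
    equivalent u' v' -> Lambda u' `<=` Lambda v'.
  by move=> hu hv uv; apply/seteqP; split; apply: H => //; exact: equivalent_sym.
move=> hu hv uv f /(LambdaP _ hu)[c c0 hf]; apply/(LambdaP _ hv).
have h1 := on_level_pos2 1%:pos hf.
exists (v' (1%:pos%:num, f 1%:pos)); first by case: h1 => ? ?; exact: utility_gt0.
move=> x; have [fx0 fxE] := hf x; split => //.
apply: (equivalent_indifference uv); [exact/pos2_nneg2/on_level_pos2|exact/pos2_nneg2|].
by rewrite fxE; case: (hf 1%:pos).
Qed.

Lemma infconv_ge (R : realType) (f g : {posnum R} -> R) (x : {posnum R}) (y : R) :
  (forall x1 x2 : {posnum R}, x1%:num + x2%:num = x%:num -> y <= f x1 + g x2) ->
  y <= infconv f g x.
Proof.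
move=> h; apply: lb_le_inf; last by move=> _ [x1 [x2 [E ->]]]; exact: h.
(* The equal split shows that the set is nonempty, as a lower bound for its infimum requires. *)
exists (f (x%:num / 2)%:pos + g (x%:num / 2)%:pos).
by exists (x%:num / 2)%:pos, (x%:num / 2)%:pos; split => //=; rewrite -splitr.
Qed.

Lemma infconv_le (R : realType) (f g : {posnum R} -> R) (x x1 x2 : {posnum R}) :
  (forall t, 0 < f t) -> (forall t, 0 < g t) ->
  x1%:num + x2%:num = x%:num -> infconv f g x <= f x1 + g x2.
Proof.
move=> f0 g0 E; apply: ge_inf; last by exists x1, x2.
by exists 0 => _ [y1 [y2 [_ ->]]]; rewrite ltW// addr_gt0.
Qed.

Lemma infconvC (R : realType) (f g : {posnum R} -> R) : infconv f g = infconv g f.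
Proof.
apply/funext => x; congr inf; apply/seteqP.
by split => _ [x1 [x2 [E ->]]]; exists x2, x1; rewrite addrC E addrC.
Qed.

Lemma infconv_setC (R : realType) (F G : set ({posnum R} -> R)) :
  infconv_set F G = infconv_set G F.
Proof.
apply/seteqP; split => _ [f Ff [g Gg <-]]; exists g => //; exists f => //;
  by rewrite infconvC.
Qed.

Lemma quasiconcave (R : realType) (u : R * R -> R) (z z' : R * R) (t c : R) :
  satisfies_I_IV u -> pos2 z -> pos2 z' -> 0 < t -> t < 1 ->
  c <= u z -> c <= u z' -> c <= u (t *: z + (1 - t) *: z').
Proof.
move=> [_ _ _ [_ cu] _] hz hz' t0 t1 cz cz'.
have [<-|zz'] := eqVneq z z'; first by rewrite -scalerDl addrCA subrr addr0 scale1r.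
apply: le_trans (ltW (cu _ _ _ hz hz' zz' t0 t1)).
rewrite -[c](_ : t * c + (1 - t) * c = c); last by ring.
by apply: lerD; apply: ler_wpM2l => //; rewrite ltW// subr_gt0.
Qed.

Lemma homothetic_infconv (R : realType) (v : R * R -> R) (a b : R)
    (f g : {posnum R} -> R) :
  satisfies_I_IV v -> represents_homothetic v -> 0 < a -> 0 < b ->
  on_level v (v (a, a)) f -> on_level v (v (b, b)) g ->
  on_level v (v (a + b, a + b)) (infconv f g).
Proof.
move=> hv hh a0 b0 hf hg x.
have ab0 := addr_gt0 a0 b0; have s0 := utility_gt0 hv ab0 ab0.
have abn0 : a + b != 0 by rewrite gt_eqF.
have hd (t : R) : 0 < t -> pos2 (t, t) by [].
have diag (k t : R) : (k * t, k * t) = k *: (t, t) by [].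
have [y y0 Ey] := level_point hv (posnum_gt0 x) s0.
have hxy : pos2 (x%:num, y) by split => /=.
have scaled k (h : {posnum R} -> R) (xk : {posnum R}) : 0 < k ->
    on_level v (v (k, k)) h -> xk%:num = k / (a + b) * x%:num ->
    h xk = k / (a + b) * y.
  move=> k0 hh' Exk; have kab := divr_gt0 k0 ab0.
  have [h0 Eh] := hh' xk.
  apply: (utility_inj2 hv (posnum_gt0 xk)) => //; first exact: mulr_gt0.
  rewrite Eh -[RHS]/(v (xk%:num, _)) Exk.
  rewrite -[RHS]/(v ((k / (a + b)) *: (x%:num, y))).
  rewrite (homothetic_scale_eq hh kab hxy (hd _ ab0) Ey) -diag.
  by rewrite divfK.
have E : infconv f g x = y.
  apply/le_anti/andP; split.
    (* The infimum is attained by splitting [x] in the proportion [a : b], where both curves are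
       contractions of the curve through [(x, y)]. *)
    have xa0 : 0 < a / (a + b) * x%:num by rewrite mulr_gt0// divr_gt0.
    have xb0 : 0 < b / (a + b) * x%:num by rewrite mulr_gt0// divr_gt0.
    apply: le_trans (@infconv_le _ f g x (PosNum xa0) (PosNum xb0) _ _ _) _ => //=.
    - by move=> t; case: (hf t).
    - by move=> t; case: (hg t).
    - by field.
    rewrite (scaled a f (PosNum xa0))// (scaled b g (PosNum xb0))//.
    by rewrite -mulrDl -mulrDl divff// mul1r.
  apply: infconv_ge => x1 x2 Ex.
  have p1 := on_level_pos2 x1 hf; have p2 := on_level_pos2 x2 hg.
  have [f0 Ef] := hf x1; have [g0 Eg] := hg x2.
  apply: (utility_lel2 hv (posnum_gt0 x)) => //; first exact: addr_gt0.
  rewrite Ey -Ex.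
  (* For an arbitrary split, both points are rescaled to the level of [(1, 1)], averaged with
     weights [a / (a + b)] and [b / (a + b)], and dilated by [a + b]: this yields exactly their sum,
     which quasiconcavity keeps above the required level. *)
  have ai0 : 0 < a^-1 by rewrite invr_gt0.
  have bi0 : 0 < b^-1 by rewrite invr_gt0.
  have d1 : v (a^-1 *: (x1%:num, f x1)) = v (1, 1).
    by rewrite (homothetic_scale_eq hh ai0 p1 (hd _ a0) Ef) -diag mulVf ?gt_eqF.
  have d2 : v (b^-1 *: (x2%:num, g x2)) = v (1, 1).
    by rewrite (homothetic_scale_eq hh bi0 p2 (hd _ b0) Eg) -diag mulVf ?gt_eqF.
  have t0 : 0 < a / (a + b) by rewrite divr_gt0.
  have t1 : a / (a + b) < 1 by rewrite ltr_pdivrMr// mul1r ltrDl.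
  have q1 := pos2_scale ai0 p1; have q2 := pos2_scale bi0 p2.
  have := quasiconcave (c := v (1, 1)) hv q1 q2 t0 t1.
  rewrite d1 d2 => /(_ (lexx _) (lexx _)).
  move=> /(homothetic_scale_le hh ab0 (hd _ ltr01)).
  have -> : 1 - a / (a + b) = b / (a + b) by field.
  rewrite -diag mulr1 => h; rewrite [X in _ <= v X](_ : (_, _) = (a + b) *:
    (a / (a + b) *: (a^-1 *: (x1%:num, f x1)) +
     b / (a + b) *: (b^-1 *: (x2%:num, g x2)))).
    apply: h; apply: pos2_add; apply: pos2_scale => //; exact: divr_gt0.
  by congr pair; rewrite /= /GRing.scale /=; field; rewrite abn0 ?gt_eqF.
by rewrite E.
Qed.

Lemma homothetic_infconv_set (R : realType) (v : R * R -> R) :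
  satisfies_I_IV v -> represents_homothetic v ->
  infconv_set (Lambda v) (Lambda v) = Lambda v.
Proof.
move=> hv hh; apply/seteqP; split => [_ [f Ff [g Gg <-]]|l].
  have [_ /(diagonal_point hv)[a a0 <-] hf] := (LambdaP _ hv).1 Ff.
  have [_ /(diagonal_point hv)[b b0 <-] hg] := (LambdaP _ hv).1 Gg.
  apply/(LambdaP _ hv); exists (v (a + b, a + b)); last exact: homothetic_infconv.
  by apply: utility_gt0 => //; exact: addr_gt0.
move=> /(LambdaP _ hv)[_ /(diagonal_point hv)[a a0 <-] hl].
have a20 : 0 < a / 2 by rewrite divr_gt0.
have v0 := utility_gt0 hv a20 a20.
have [f hf] := level_curve_exists hv v0.
have Ff : Lambda v f by apply/(LambdaP _ hv); exists (v (a / 2, a / 2)).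
exists f => //; exists f => //.
apply: on_level_unique hl => //.
by rewrite [X in (X, _)]splitr [X in (_, X)]splitr; exact: homothetic_infconv.
Qed.

(** Convolving [f] with a curve [g] of low enough level gives a level curve of [v] that is nowhere
    below [f] and close to it at a chosen abscissa. If [v] were smaller at [s'] than at [s] along
    [f], such a curve could not have constant value. *)
Lemma infconv_closed_const (R : realType) (u1 u2 v : R * R -> R) f (x x' : {posnum R}) :
  satisfies_I_IV u1 -> satisfies_I_IV u2 -> satisfies_I_IV v ->
  infconv_set (Lambda u1) (Lambda u2) `<=` Lambda v -> Lambda u1 f ->
  v (x%:num, f x) = v (x'%:num, f x').
Proof.
move=> hu1 hu2 hv closed Ff.
suff H s s' : v (s%:num, f s) <= v (s'%:num, f s') by apply/le_anti; rewrite !H.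
rewrite leNgt; apply/negP => vlt.
have [c1 c10 hf] := (LambdaP _ hu1).1 Ff.
have [fs0 Efs] := hf s; have [fs'0 Efs'] := hf s'.
have vs0 := utility_gt0 hv (posnum_gt0 s) fs0.
have [y y0 Ey] := level_point hv (posnum_gt0 s') vs0.
have fy : f s' < y by apply: (utility_ltl2 hv (posnum_gt0 s')) => //; rewrite Ey.
(* Halfway up the gap, plus a further quarter of it, so that [m + d] stays below [y]. *)
pose m := (f s' + y) / 2; pose d := (y - f s') / 4.
have d0 : 0 < d by rewrite /d divr_gt0// subr_gt0.
have fm : f s' < m by rewrite /m; lra.
have m0 : 0 < m by exact: lt_trans fm.
have c1m : c1 < u1 (s'%:num, m) by rewrite -Efs'; exact: utility_lt2.
(* The curve [f] takes the value [m] slightly to the left, at [r]; [g] is then chosen through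
   [(s' - r, d)], so that this split bounds the convolution at [s'] by [m + d]. *)
have [r /andP[r0 rs] Er] := horizontal_point hu1 (posnum_gt0 s') m0 c10 c1m.
have e0 : 0 < s'%:num - r by rewrite subr_gt0.
have [g hg] := level_curve_exists hu2 (utility_gt0 hu2 e0 d0).
have Gg : Lambda u2 g.
  by apply/(LambdaP _ hu2); eexists; last exact: hg; exact: utility_gt0.
have /(LambdaP _ hv)[c c0 hh] : Lambda v (infconv f g).
  by apply: closed; exists f => //; exists g.
have Efr : f (PosNum r0) = m.
  have [fr0 Efr] := hf (PosNum r0).
  by apply: (utility_inj2 hu1 r0) => //; rewrite Er -Efr.
have Ege : g (PosNum e0) = d.
  have [ge0 Ege] := hg (PosNum e0).
  exact: (utility_inj2 hu2 e0).
have hs' : infconv f g s' <= m + d.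
  rewrite -Efr -Ege; apply: infconv_le => /=.
  - by move=> t; case: (hf t).
  - by move=> t; case: (hg t).
  - by rewrite addrC subrK.
have hs : f s <= infconv f g s.
  apply: infconv_ge => x1 x2 Ex; have [g0 _] := hg x2.
  have [fx0 Efx] := hf x1.
  rewrite -[f s]addr0; apply: lerD; last exact: ltW.
  apply: (utility_lel2 hu1 (posnum_gt0 s)) => //; rewrite Efs -Efx.
  by apply: utility_le => //; rewrite -Ex lerDl ltW.
have [hs0 Ehs] := hh s; have [hs'0 Ehs'] := hh s'.
have := utility_le hv (posnum_gt0 s) fs0 (lexx _) hs.
rewrite Ehs -Ehs' -Ey => hle.
have : y <= infconv f g s' by exact: (utility_lel2 hv (posnum_gt0 s')).
by rewrite leNgt => /negP; apply; apply: le_lt_trans hs' _; rewrite /m /d; lra.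
Qed.

Lemma infconv_closed_equivalent (R : realType) (u1 u2 v : R * R -> R) :
  satisfies_I_IV u1 -> satisfies_I_IV u2 -> satisfies_I_IV v ->
  infconv_set (Lambda u1) (Lambda u2) `<=` Lambda v -> equivalent u1 v.
Proof.
move=> hu1 hu2 hv closed; apply: indifference_equivalent => // -[x y] [x' y'].
move=> [/= x0 y0] [/= x'0 y'0] E.
have u0 := utility_gt0 hu1 x0 y0.
have [f hf] := level_curve_exists hu1 u0.
have Ff : Lambda u1 f by apply/(LambdaP _ hu1); exists (u1 (x, y)).
have [fx0 Ex] := hf (PosNum x0); have [fx'0 Ex'] := hf (PosNum x'0).
rewrite (utility_inj2 hu1 x0 y0 fx0 (esym Ex)).
rewrite (utility_inj2 hu1 x'0 y'0 fx'0 (etrans (esym E) (esym Ex'))).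
exact: (@infconv_closed_const _ u1 u2 v f (PosNum x0) (PosNum x'0)).
Qed.

(** The witness [h] is the convolution of [n.+1] copies of [f]: equal shares give the upper bound,
    and convexity of [f] shows that no other split does better. *)
Lemma infconv_closed_scaled_curve (R : realType) (u : R * R -> R) f (n : nat) :
  satisfies_I_IV u -> infconv_set (Lambda u) (Lambda u) `<=` Lambda u ->
  Lambda u f ->
  exists2 h, Lambda u h & forall x x' : {posnum R},
    x'%:num = n.+1%:R * x%:num -> h x' = n.+1%:R * f x.
Proof.
move=> hu closed Ff; elim: n => [|n [h Fh Eh]].
  by exists f => // x x'; rewrite !mul1r => /val_inj ->.
exists (infconv h f); first by apply: closed; exists h => //; exists f.
move=> x x' E.
have [c c0 hf] := (LambdaP _ hu).1 Ff; have [d d0 hh] := (LambdaP _ hu).1 Fh.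
have nS : n.+2%:R = n.+1%:R + 1 :> R by rewrite -natr1.
set N : R := n.+1%:R in nS Eh *; have N0 : 0 < N by rewrite ltr0n.
apply/le_anti/andP; split.
  have xn0 : 0 < N * x%:num by rewrite mulr_gt0.
  apply: le_trans (@infconv_le _ h f x' (PosNum xn0) x _ _ _) _ => //=.
  - by move=> t; case: (hh t).
  - by move=> t; case: (hf t).
  - by rewrite E nS; ring.
  by rewrite (Eh x (PosNum xn0))// nS; lra.
apply: infconv_ge => x1 x2 Ex.
have xn0 : 0 < x1%:num / N by rewrite divr_gt0.
have -> : h x1 = N * f (PosNum xn0) by apply: Eh => /=; field; rewrite gt_eqF.
have [f0 Ef] := hf (PosNum xn0); have [f20 Ef2] := hf x2.
have p1 := on_level_pos2 (PosNum xn0) hf; have p2 := on_level_pos2 x2 hf.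
have N10 : 0 < N + 1 by rewrite addr_gt0.
have t0 : 0 < N / (N + 1) by rewrite divr_gt0.
have t1 : N / (N + 1) < 1 by rewrite ltr_pdivrMr// mul1r ltrDl.
(* Convexity of [f] in the form of quasiconcavity of [u]: the mean of [N] copies of the point over
   [x1 / N] and one copy of the point over [x2] lies above [x]. *)
have := quasiconcave (c := c) hu p1 p2 t0 t1; rewrite Ef Ef2 => /(_ (lexx _) (lexx _)).
have [fx0 Efx] := hf x.
rewrite (_ : _ + _ = (x%:num, (N * f (PosNum xn0) + f x2) / (N + 1))); last first.
  congr pair; rewrite /= /GRing.scale /=; last by field; rewrite gt_eqF.
  have -> : x%:num = x'%:num / (N + 1) by rewrite E nS mulrAC divff ?mul1r// gt_eqF.
  by rewrite -Ex; field; rewrite !gt_eqF.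
rewrite -Efx => hle; rewrite nS mulrC -ler_pdivlMr//.
apply: (utility_lel2 hu (posnum_gt0 x)) => //.
by rewrite divr_gt0// addr_gt0// mulr_gt0.
Qed.

Lemma infconv_closed_homothetic (R : realType) (u : R * R -> R) :
  satisfies_I_IV u -> infconv_set (Lambda u) (Lambda u) `<=` Lambda u ->
  represents_homothetic u.
Proof.
move=> hu closed; apply: homothetic_of_nat_scale => // n [x y] [x' y'].
move=> [/= x0 y0] [/= x'0 y'0] E.
have [f hf] := level_curve_exists hu (utility_gt0 hu x0 y0).
have Ff : Lambda u f.
  by apply/(LambdaP _ hu); exists (u (x, y)) => //; exact: utility_gt0.
have [h /(LambdaP _ hu)[c c0 hh] Eh] := infconv_closed_scaled_curve n hu closed Ff.
have [fx0 Ex] := hf (PosNum x0); have [fx'0 Ex'] := hf (PosNum x'0).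
rewrite (utility_inj2 hu x0 y0 fx0 (esym Ex)).
rewrite (utility_inj2 hu x'0 y'0 fx'0 (etrans (esym E) (esym Ex'))).
have N0 : 0 < n.+1%:R :> R by rewrite ltr0n.
have X (t : R) (t0 : 0 < t) : u (n.+1%:R *: (t, f (PosNum t0))) = c.
  have nt0 := mulr_gt0 N0 t0.
  have [_ <-] := hh (PosNum nt0); rewrite (Eh (PosNum t0) (PosNum nt0))//.
by rewrite !X.
Qed.

(** * Equal prices give equal level curves *)

(** Over a uniform partition into [N] pieces, the factors [y - x] are all [(b - a) / N] and the
    increments of [Q] telescope, so the total increment of [W] is at most a constant over [N]. *)
Lemma product_increments_const (R : realType) (W Q : R -> R) (a b M : R) :
  a <= b ->
  (forall x y, a <= x -> x <= y -> y <= b ->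
     `|W y - W x| <= M * ((Q x - Q y) * (y - x))) ->
  W a = W b.
Proof.
move=> ab H; apply/eqP; rewrite eq_sym -subr_eq0 -normr_le0 leNgt; apply/negP => d0.
set D := `|_| in d0; pose K := M * ((Q a - Q b) * (b - a)).
(* Enough pieces that [K / N] falls below the supposed nonzero increment [D]. *)
pose N := (Num.truncn (K / D)).+1; pose s := (b - a) / N%:R.
have N0 : 0 < N%:R :> R by rewrite ltr0n.
have KN : K < D * N%:R by rewrite mulrC -ltr_pdivrMr// /N truncnS_gt.
have s0 : 0 <= s by rewrite divr_ge0 ?subr_ge0// ltW.
pose x (i : nat) := a + i%:R * s.
have x0 : x 0%N = a by rewrite /x mul0r addr0.
have xN : x N = b by rewrite /x /s mulrCA divff ?mulr1 ?gt_eqF// addrC subrK.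
have xS i : x i.+1 - x i = s by rewrite /x -natr1; ring.
have xle i j : (i <= j)%N -> x i <= x j.
  by move=> ij; rewrite /x lerD2l ler_wpM2r// ler_nat.
have : D <= \sum_(0 <= i < N) M * ((Q (x i) - Q (x i.+1)) * s).
  rewrite /D -xN -x0 -(@telescope_sumr _ 0 N (fun i => W (x i)))//.
  apply: le_trans (ler_norm_sum _ _ _) _.
  apply: ler_sum_nat => i /andP[_ iN]; rewrite -(xS i); apply: H.
  - by rewrite -x0 xle.
  - exact: xle.
  - by rewrite -xN xle.
rewrite -mulr_sumr -mulr_suml.
rewrite (@telescope_sumr_eq _ 0 N (fun i => - Q (x i)))//; last first.
  by move=> k _; rewrite opprK addrC.
rewrite opprK addrC x0 xN mulrA -/s /s mulrA -[M * _ * _]mulrA -/K.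
by rewrite ler_pdivlMr// leNgt KN.
Qed.

(** Comparing [z] with the point at half its height, where [u] is still positive, bounds the
    derivative by values of [u] and gives a uniform bound along an arc. *)
Lemma dy_le (R : realType) (u : R * R -> R) (z : R * R) :
  satisfies_I_IV u -> pos2 z -> dy u z <= 2 * u z / z.2.
Proof.
case: z => x y hu hz; have [/= x0 y0] := hz.
have y20 : 0 < y / 2 by rewrite divr_gt0.
have := @price_supergradient _ u (x, y) (x, y / 2) hu hz.
move=> /(_ (conj x0 y20)) /=; have := utility_gt0 hu x0 y20.
by rewrite subrr mulr0 add0r ler_pdivlMr//; lra.
Qed.

(* Along a level curve of [u], the supergradient inequality bounds each increment
   of [v (k *: _)] by a product of the increments of the price and of [x];
   summing over fine partitions, the total increment vanishes. *)
Lemma same_price_indifference (R : realType) (u v : R * R -> R) (k : R) :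
  satisfies_I_IV u -> satisfies_I_IV v -> 0 < k ->
  (forall z, pos2 z -> price v (k *: z) = price u z) ->
  forall z z', pos2 z -> pos2 z' -> u z = u z' -> v (k *: z) = v (k *: z').
Proof.
move=> hu hv k0 Hp [x1 y1] [x2 y2].
wlog x12 : x1 y1 x2 y2 / x1 <= x2.
  move=> H hz hz' E; have [|/ltW] := leP x1 x2 => x12; first exact: H.
  by apply/esym; apply: H.
move=> hz hz' E; have [/= x10 y10] := hz; have [/= x20 y20] := hz'.
pose c := u (x1, y1); have c0 : 0 < c by exact: utility_gt0.
(* The level curve is extended to all reals, with an irrelevant value at nonpositive abscissas. *)
have /choice[f hf] : forall x : R, exists y, 0 < x -> 0 < y /\ u (x, y) = c.
  move=> x; have [x0|_] := ltP 0 x; last by exists 0.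
  by have [y y0 Ey] := level_point hu x0 c0; exists y.
have f1 : f x1 = y1.
  by have [f0 Ef] := hf _ x10; apply: (utility_inj2 hu x10).
have f2 : f x2 = y2.
  by have [f0 Ef] := hf _ x20; apply: (utility_inj2 hu x20) => //; rewrite Ef -E.
have fle x y : 0 < x -> x <= y -> f y <= f x.
  move=> x0 xy; have y0 := lt_le_trans x0 xy.
  have [fx0 Ex] := hf _ x0; have [fy0 Ey] := hf _ y0.
  by apply: (utility_lel2 hu y0) => //; rewrite Ey -Ex utility_le.
pose w z := v (k *: z); pose P x := price u (x, f x).
(* Every point of the arc is dominated by [(x2, y1)] and has height at least [y2], so [dy_le] at the
   dilated point bounds [k * dy v] by [M]. *)
pose M := 2 * w (x2, y1) / y2.
have supp x y : 0 < x -> 0 < y -> P x * x + f x <= P x * y + f y.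
  move=> x0 y0; have [fx0 Ex] := hf _ x0; have [fy0 Ey] := hf _ y0.
  rewrite leNgt; apply/negP => lt.
  have xy : (y, f y) != (x, f x) by apply/eqP => -[? ?]; subst; rewrite ltxx in lt.
  have := @price_supports _ u (x, f x) (y, f y) hu _ _ xy (ltW lt).
  rewrite Ex Ey ltxx => h; suff : false by []; apply: h; first by [].
  by split => /=; exact: ltW.
have sg x y : x1 <= x -> x <= x2 -> 0 < y ->
    w (y, f y) - w (x, f x) <= M * ((P x - P y) * (y - x)).
  move=> x1x xx2 y0; have x0 := lt_le_trans x10 x1x.
  have [fx0 Ex] := hf _ x0; have [fy0 Ey] := hf _ y0.
  have px : pos2 (x, f x) by []; have py : pos2 (y, f y) by [].
  have := price_supergradient hv (pos2_scale k0 px) (pos2_scale k0 py).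
  rewrite Hp// -/(w _) -/(w _) -/(P x) /= /GRing.scale /= => h.
  (* The supporting line at [y] gives this upper bound, the one at [x] the nonnegativity in
     [inc0]. *)
  have inc : P x * (y - x) + (f y - f x) <= (P x - P y) * (y - x).
    by have := supp y x y0 x0; lra.
  have inc0 : 0 <= P x * (y - x) + (f y - f x) by have := supp x y x0 y0; lra.
  have DM : k * dy v (k * x, k * f x) <= M.
    have := dy_le hv (pos2_scale k0 px); rewrite /= /GRing.scale /= => hd.
    rewrite -ler_pdivlMl//; apply: le_trans hd _.
    have -> : k^-1 * M = 2 * w (x2, y1) / (k * y2).
      by rewrite /M; field; rewrite !gt_eqF.
    apply: ler_pM.
    - by rewrite mulr_ge0// ltW// utility_gt0// mulr_gt0.
    - by rewrite invr_ge0 ltW// mulr_gt0.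
    - rewrite ler_pM2l//; apply: (utility_le hv); rewrite ?mulr_gt0//.
        exact: (ler_wpM2l (ltW k0)).
      by apply: (ler_wpM2l (ltW k0)); rewrite -f1 fle.
    - by rewrite lef_pV2 ?posrE ?mulr_gt0// ler_pM2l// -f2 fle.
  apply: le_trans h _; rewrite (_ : dy _ _ * _ =
    (k * dy v (k * x, k * f x)) * (P x * (y - x) + (f y - f x))); last by ring.
  apply: ler_pM => //.
  by rewrite mulr_ge0 ?(ltW k0)// ltW// dy_gt0//; apply: pos2_scale k0 px.
suff : w (x1, f x1) = w (x2, f x2) by rewrite f1 f2.
apply: (@product_increments_const _ (fun x => w (x, f x)) P x1 x2 M x12).
move=> x y x1x xy yx2; have x0 := lt_le_trans x10 x1x; have y0 := lt_le_trans x0 xy.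
rewrite ler_norml sg ?andbT// ?(le_trans xy)//.
(* The other half of the absolute value is [sg] with the points exchanged, since the product of
   increments is symmetric. *)
rewrite lerNl opprB; have := sg y x (le_trans x1x xy) yx2 x0.
by congr (_ <= _); ring.
Qed.

(** * Representative agents *)

(** Strict optimality on the budget set, phrased through comparisons of values alone so that it
    passes to equivalent functions. *)
Definition supports {R : realType} (u : R * R -> R) (z : R * R) (p : R) :=
  forall z', nneg2 z' -> z' != z -> p * z'.1 + z'.2 <= p * z.1 + z.2 -> u z' < u z.

Lemma supports_price (R : realType) (u : R * R -> R) (z : R * R) :
  satisfies_I_IV u -> pos2 z -> supports u z (price u z).
Proof. by move=> hu hz z'; exact: price_supports. Qed.

Lemma supports_equivalent (R : realType) (u v : R * R -> R) (z : R * R) (p : R) :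
  equivalent u v -> nneg2 z -> supports u z p -> supports v z p.
Proof.
move=> uv hz hs z' hz' zz' hp; rewrite ltNge; apply/negP => /uv -/(_ hz' hz).
by rewrite leNgt hs.
Qed.

Lemma supports_scale (R : realType) (v : R * R -> R) (z : R * R) (p k : R) :
  satisfies_I_IV v -> represents_homothetic v -> pos2 z -> 0 < k ->
  supports v z p -> supports v (k *: z) p.
Proof.
move=> hv hh hz k0 hs z' hz' zz' hp; have hkz := pos2_scale k0 hz.
have [pz'|nz'] := pselect (pos2 z'); last first.
  rewrite (utility_off_pos2 hv hz' nz').
  by case: (k *: z) hkz => x y [? ?]; exact: utility_gt0.
have ki0 : 0 < k^-1 by rewrite invr_gt0.
have kn0 : k != 0 by rewrite gt_eqF.
rewrite ltNge; apply/negP => /(homothetic_scale_le hh ki0 hkz pz').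
rewrite scalerA mulVf// scale1r leNgt hs//.
- exact/pos2_nneg2/pos2_scale.
- by apply: contra_neq zz' => <-; rewrite scalerA divff// scale1r.
- move: hp; rewrite /= /GRing.scale /= => hp.
  rewrite (_ : _ + _ = k^-1 * (p * z'.1 + z'.2)); last by ring.
  rewrite ler_pdivrMl//; apply: le_trans hp _.
  by rewrite mulrDr [k * (p * _)]mulrCA.
Qed.

(** Scaling [z1] to the budget of [z2] gives two strict optima of the same budget set, which must
    coincide. *)
Lemma supports_ray (R : realType) (v : R * R -> R) (z1 z2 : R * R) (p : R) :
  satisfies_I_IV v -> represents_homothetic v -> 0 < p -> pos2 z1 -> pos2 z2 ->
  supports v z1 p -> supports v z2 p -> exists2 k, 0 < k & z2 = k *: z1.
Proof.
move=> hv hh p0 h1 h2 s1 s2.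
have m0 (z : R * R) : pos2 z -> 0 < p * z.1 + z.2.
  by move=> [? ?]; rewrite addr_gt0// mulr_gt0.
pose k := (p * z2.1 + z2.2) / (p * z1.1 + z1.2).
have k0 : 0 < k by rewrite divr_gt0// m0.
have Ek : p * (k *: z1).1 + (k *: z1).2 = p * z2.1 + z2.2.
  rewrite /= /GRing.scale /= mulrCA -mulrDr /k divfK// gt_eqF// m0//.
exists k => //; apply/eqP/negPn/negP => ne.
have := supports_scale hv hh h1 k0 s1 (pos2_nneg2 h2) ne.
rewrite Ek lexx => /(_ isT); rewrite ltNge => /negP; apply; apply: ltW.
apply: s2; first exact/pos2_nneg2/pos2_scale.
  by rewrite eq_sym.
by rewrite Ek.
Qed.

(** A nonzero trade that keeps [phi] constant must raise the worth of the inventory at price [p]; it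
    therefore lowers that of the trader's holding, where [b] is optimal. *)
Lemma supports_no_gain (R : realType) (phi u : R * R -> R) (a b h : R * R) (p : R) :
  supports phi a p -> supports u b p -> valid_trade phi a b h -> u (b - h) <= u b.
Proof.
move=> sphi su [ah Eh bh].
have [->|h0] := eqVneq h 0; first by rewrite subr0.
have ha : a + h != a by rewrite -subr_eq0 addrAC subrr add0r.
apply/ltW/su => //; first by rewrite -subr_eq0 addrAC subrr add0r oppr_eq0.
have [hp|hp] := leP (p * (a + h).1 + (a + h).2) (p * a.1 + a.2).
  by have := sphi _ ah ha hp; rewrite Eh ltxx.
by move: hp => /=; lra.
Qed.

Lemma homothetic_strong_representative (R : realType) (phi u1 u2 v : R * R -> R) :
  satisfies_I_IV phi -> satisfies_I_IV u1 -> satisfies_I_IV u2 ->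
  satisfies_I_IV v -> equivalent u1 v -> equivalent u2 v ->
  represents_homothetic v -> strong_representative phi u1 u2 v.
Proof.
move=> hphi hu1 hu2 hv e1 e2 hh Sin S [i0 i1 i2] [[m0 m1 m2]].
move=> [Esum Ephi le1 le2] [_ eq1 eq2].
have gt0_pos2 (u : R * R -> R) z : satisfies_I_IV u -> pos2 z -> 0 < u z.
  by case: z => x y hu [? ?]; exact: utility_gt0.
have p0 : pos2 (r0 S).
  by apply: (utility_gt0_pos2 hphi m0); rewrite Ephi gt0_pos2.
have p1 : pos2 (r1 S).
  by apply: (utility_gt0_pos2 hu1 m1); apply: lt_le_trans le1; exact: gt0_pos2.
have p2 : pos2 (r2 S).
  by apply: (utility_gt0_pos2 hu2 m2); apply: lt_le_trans le2; exact: gt0_pos2.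
have t1 := tangency hphi hu1 p0 p1 eq1; have t2 := tangency hphi hu2 p0 p2 eq2.
have pp := price_gt0 hphi p0.
have s0 := supports_price hphi p0.
have s1 := supports_equivalent e1 m1 (supports_price hu1 p1).
have s2 := supports_equivalent e2 m2 (supports_price hu2 p2).
rewrite -t1 in s1; rewrite -t2 in s2.
have [k k0 Ek] := supports_ray hv hh pp p1 p2 s1 s2.
have s12 : supports v (r1 S + r2 S) (price phi (r0 S)).
  rewrite Ek -[X in X + _]scale1r -scalerDl.
  by apply: supports_scale => //; rewrite addr_gt0.
have EA : r1 Sin + r2 Sin - (r0 S - r0 Sin) = r1 S + r2 S.
  apply: (addIr (r0 S - r0 Sin)); rewrite subrK; apply: (addIr (r0 Sin)).
  by rewrite -[RHS]addrA subrK [LHS]addrC [RHS]addrC !addrA.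
split; first split.
- by rewrite addrC subrK.
- by rewrite addrC subrK.
- by rewrite EA; exact/pos2_nneg2/pos2_add.
move=> h [h1 h2 h3]; rewrite EA.
(* A trade [h] from the initial state is the trade [h] minus the equilibrium trade, carried out from
   the final state, where [supports_no_gain] applies. *)
have Eh : r1 Sin + r2 Sin - h = r1 S + r2 S - (h - (r0 S - r0 Sin)).
  by rewrite -EA; set d := r0 S - _; rewrite (opprB h) [RHS]addrA subrK.
have Eq : r0 S + (h - (r0 S - r0 Sin)) = r0 Sin + h.
  by rewrite opprB addrCA [r0 S + _]addrCA subrr addr0 addrC.
rewrite Eh; apply: (supports_no_gain s0 s12).
by split; rewrite ?Eq ?h2 -?Eh.
Qed.

Lemma strong_price_add (R : realType) (phi u1 u2 v : R * R -> R) (z1 z2 : R * R) (p : R) :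
  satisfies_I_IV phi -> satisfies_I_IV u1 -> satisfies_I_IV u2 ->
  satisfies_I_IV v -> strong_representative phi u1 u2 v ->
  pos2 z1 -> pos2 z2 -> price u1 z1 = p -> price u2 z2 = p ->
  price v (z1 + z2) = p.
Proof.
move=> hphi hu1 hu2 hv strong h1 h2 E1 E2.
have p0 : 0 < p by rewrite -E1 price_gt0.
have [r [hr _ Er]] := price_on_budget hphi p0 (@ltr01 R).
have sr : supports phi r p by rewrite -Er; exact: supports_price.
have s1 : supports u1 z1 p by rewrite -E1; exact: supports_price.
have s2 : supports u2 z2 p by rewrite -E2; exact: supports_price.
(* This state serves both as initial state and as equilibrium, so the representative's optimal trade
   is zero and tangency can be read off at [z1 + z2]. *)
pose S := MState r z1 z2.
have state : is_market_state S by split; exact: pos2_nneg2.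
have eqS : unilateral_equilibrium phi u1 u2 S.
  by split => //= -[h [vh]]; rewrite ltNge => /negP; apply;
    [exact: supports_no_gain sr s1 vh|exact: supports_no_gain sr s2 vh].
have reach : reachable phi u1 u2 S S by [].
have [//|_ wmax] := strong S S _ reach eqS.
rewrite -Er; apply/esym/tangency => //; first exact: pos2_add.
move=> [h [vh]]; rewrite ltNge => /negP; apply.
by have := wmax h vh; rewrite /= subrr subr0.
Qed.

(* As the budget [m] shrinks, the point [z2] of [u2] at price [p] tends to [0],
   so [p] is also the price of [v] at [z1]. *)
Lemma price_of_add (R : realType) (u2 v : R * R -> R) (z1 : R * R) (p : R) :
  satisfies_I_IV u2 -> satisfies_I_IV v -> pos2 z1 -> 0 < p ->
  (forall z2, pos2 z2 -> price u2 z2 = p -> price v (z1 + z2) = p) ->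
  price v z1 = p.
Proof.
move=> hu2 hv h1 p0 H; apply: budget_max_price => // z' hz' Ez'.
apply/ler_addgt0Pr => e e0.
(* Chosen so that the gradient of [v] at [z1] applied to [z2] is at most [C] times the budget of
   [z2]; the budget [e / C] makes this equal to [e]. *)
pose C := dx v z1 / p + dy v z1.
have dx0 := dx_gt0 hv h1; have dy0 := dy_gt0 hv h1.
have C0 : 0 < C by rewrite addr_gt0// divr_gt0.
have m0 : 0 < e / C by rewrite divr_gt0.
have [z2 [h2 Em E2]] := price_on_budget hu2 p0 m0.
have [z21 z22] := h2.
have h12 := pos2_add h1 h2.
have zz : z' != z1 + z2.
  apply/eqP => E; move: Ez'; rewrite E /=.
  by have := mulr_gt0 p0 z21; lra.
apply: (@le_trans _ _ (v (z1 + z2))).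
  have := @price_supports _ v (z1 + z2) z' hv h12 (pos2_nneg2 hz') zz.
  rewrite H// => h; apply/ltW/h; rewrite Ez' /=.
  by have := mulr_gt0 p0 z21; lra.
rewrite -lerBlDl; apply: le_trans (concave_le_grad hv h1 h12) _.
have -> : e = C * (p * z2.1 + z2.2) by rewrite Em mulrC divfK// gt_eqF.
have -> : C * (p * z2.1 + z2.2) = z2.1 * dx v z1 + z2.2 * dy v z1 +
    (dx v z1 / p * z2.2 + dy v z1 * p * z2.1).
  by rewrite /C; field; rewrite gt_eqF.
rewrite /= !(addrAC _ _ (- _)) !subrr !add0r lerDl.
by rewrite addr_ge0// ltW// !mulr_gt0// invr_gt0.
Qed.

Lemma strong_representative_homothetic (R : realType) (phi u1 u2 v : R * R -> R) :
  satisfies_I_IV phi -> satisfies_I_IV u1 -> satisfies_I_IV u2 ->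
  satisfies_I_IV v -> strong_representative phi u1 u2 v ->
  same_homothetic u1 u2 v.
Proof.
move=> hphi hu1 hu2 hv strong.
have add := strong_price_add hphi hu1 hu2 hv strong.
have P1 z : pos2 z -> price v z = price u1 z.
  move=> hz; apply: (price_of_add hu2) => //; first exact: price_gt0.
  by move=> z2 hz2; apply: add.
have P2 z : pos2 z -> price v z = price u2 z.
  move=> hz; apply: (price_of_add hu1) => //; first exact: price_gt0.
  by move=> z2 hz2 E; rewrite addrC; apply: add.
have E (u : R * R -> R) : satisfies_I_IV u ->
    (forall z, pos2 z -> price v z = price u z) -> equivalent u v.
  move=> hu P; apply: indifference_equivalent => // z z' hz hz' Ez.
  rewrite -[z]scale1r -[z']scale1r.
  by apply: (same_price_indifference hu) => // t ht; rewrite scale1r P.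
have E1 := E _ hu1 P1; have E2 := E _ hu2 P2.
(* Additivity is applied to the multiple already reached, held by the first agent, and one more copy
   of [z], held by the second; [P1] and [P2] convert between the three prices. *)
have Pn n z : pos2 z -> price v (n.+1%:R *: z) = price v z.
  move=> hz; elim: n => [|n IH]; first by rewrite scale1r.
  rewrite -natr1 scalerDl scale1r.
  have hnz : pos2 (n.+1%:R *: z) by apply: pos2_scale; rewrite ?ltr0n.
  by apply: add => //; rewrite -?P1 -?P2.
have hh : represents_homothetic v.
  apply: homothetic_of_nat_scale => // n z z' hz hz'.
  by apply: (same_price_indifference hv) => // t ht; exact: Pn.
split; split => //.
- exact: equivalent_trans E1 (equivalent_sym E2).
- exact: equivalent_homothetic E1 hh.
- exact: equivalent_homothetic E2 hh.
Qed.

Lemma infconv_same_homothetic (R : realType) (u1 u2 v : R * R -> R) :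
  satisfies_I_IV u1 -> satisfies_I_IV u2 -> satisfies_I_IV v ->
  infconv_set (Lambda u1) (Lambda u2) = Lambda v <-> same_homothetic u1 u2 v.
Proof.
move=> hu1 hu2 hv; split => [E|[[_ E2 E1] [_ _ hh]]]; last first.
  rewrite (Lambda_equivalent hu1 hv E1) (Lambda_equivalent hu2 hv E2).
  exact: homothetic_infconv_set.
have E1 : equivalent u1 v by apply: (infconv_closed_equivalent hu1 hu2); rewrite ?E.
have E2 : equivalent u2 v.
  by apply: (infconv_closed_equivalent hu2 hu1); rewrite // infconv_setC E.
(* With all three families identified, the hypothesis says that [Lambda v] is stable under
   convolution with itself. *)
move: E; rewrite (Lambda_equivalent hu1 hv E1) (Lambda_equivalent hu2 hv E2) => E.
have hh : represents_homothetic v by apply: infconv_closed_homothetic; rewrite ?E.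
split; split => //.
- exact: equivalent_trans E1 (equivalent_sym E2).
- exact: equivalent_homothetic E1 hh.
- exact: equivalent_homothetic E2 hh.
Qed.

Theorem theorem3 (R : realType) (phi u1 u2 v : R * R -> R)
    (hphi : satisfies_I_IV phi) (hu1 : satisfies_I_IV u1)
    (hu2 : satisfies_I_IV u2) (hv : satisfies_I_IV v) :
  (strong_representative phi u1 u2 v <->
     infconv_set (Lambda u1) (Lambda u2) = Lambda v) /\
  (infconv_set (Lambda u1) (Lambda u2) = Lambda v <->
     same_homothetic u1 u2 v).
Proof.
have key := infconv_same_homothetic hu1 hu2 hv; split => //; split.
  by move=> /(strong_representative_homothetic hphi hu1 hu2 hv)/key.
by move=> /key[[_ E2 E1] [_ _ hh]]; exact: homothetic_strong_representative.
Qed.
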